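(* Let $R$ be a commutative ring with non-zero identity, $M$ a unital $R$-module, and $T$ a non-empty subset of $\mathrm{Max}(M)$. Then the Zariski topology-graph $G(\tau^{m}_{T})$ is connected and $\mathrm{diam}(G(\tau^{m}_{T}))\leq 3$. Moreover, if $G(\tau^{m}_{T})$ contains a cycle, then $\mathrm{gr}(G(\tau^{m}_{T}))\leq 4$.
   Context: $\mathrm{Max}(M)$ is the set of maximal submodules of $M$. For $N\leq M$, $(N:M)=\{r\in R: rM\subseteq N\}$ and $V^{m}(N)=\{Q\in \mathrm{Max}(M):(Q:M)\supseteq (N:M)\}$. $N<M$ means that $N$ is a proper submodule of $M$. $G(\tau^{m}_{T})$ is the undirected graph whose vertices are the proper submodules $N<M$ for which there exists $L<M$ with $V^{m}(N)\cup V^{m}(L)=T$, $V^{m}(N)\neq T$ and $V^{m}(L)\neq T$; distinct vertices $N$ and $L$ are adjacent if and only if $V^{m}(N)\cup V^{m}(L)=T$. $\mathrm{diam}$ denotes the diameter (supremum of distances between vertices) and $\mathrm{gr}$ the girth (length of a shortest cycle) of a graph. *)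

(* Defs.v *)
From HB Require Import structures.
From mathcomp Require Import all_boot all_order all_algebra.
From mathcomp Require Import boolp classical_sets constructive_ereal.

Set Implicit Arguments.
Unset Strict Implicit.
Unset Printing Implicit Defensive.

Import Order.TTheory GRing.Theory Num.Theory.

Local Open Scope classical_set_scope.
Local Open Scope ring_scope.

(* Infimum of a set of naturals and supremum of a set of extended naturals,
   both computed in N U {+oo}: the infimum of set0 is +oo, the supremum of
   set0 is 0 and that of an unbounded set is +oo. *)
Definition enat_inf (A : set nat) : \bar int :=
  if pselect (exists n, `[< A n >]) is left exA then (ex_minn exA)%:Z%:E
  else +oo%E.

Definition enat_sup (B : set (\bar int)) : \bar int :=
  enat_inf [set n : nat | forall b, B b -> (b <= n%:Z%:E)%E].

Section Graphs.
Variable X : eqType.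

Record sgraph := SGraph {
  vertices : set X;
  edge : rel X;
  edge_vertices : forall x y, edge x y -> vertices x /\ vertices y;
  edge_sym : symmetric edge;
  edge_irrefl : irreflexive edge }.

Implicit Types (G : sgraph) (x y : X) (n : nat).

Definition walk G x y n : Prop :=
  exists p : seq X, [/\ path (edge G) x p, last x p = y & size p = n].

(* The empty graph is connected in this sense. *)
Definition connected_graph G : Prop :=
  forall x y, vertices G x -> vertices G y -> exists n, walk G x y n.

Definition distance G x y : \bar int := enat_inf [set n | walk G x y n].

Definition diam G : \bar int :=
  enat_sup [set d | exists x y,
              [/\ vertices G x, vertices G y & d = distance G x y]].

Definition is_graph_cycle G (c : seq X) : Prop :=
  [/\ (3 <= size c)%N, uniq c & cycle (edge G) c].

Definition gr G : \bar int :=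
  enat_inf [set n | exists c, is_graph_cycle G c /\ size c = n].

End Graphs.

Section Modules.
Variables (R : comNzRingType) (M : lmodType R).
Implicit Types N L Q : set M.

Definition submodule N : Prop := submod_closed (mem N).

Definition proper_submodule N : Prop := submodule N /\ N != setT.

Definition Max : set (set M) :=
  [set Q | proper_submodule Q /\
     forall L, proper_submodule L -> Q `<=` L -> L = Q].

Definition colon N : set R := [set r | forall x : M, N (r *: x)].

Definition Vm N : set (set M) := [set Q | Max Q /\ colon N `<=` colon Q].

Section TopologyGraph.
Variable T : set (set M).

Definition ztg_vertex N : Prop :=
  proper_submodule N /\
  exists L, [/\ proper_submodule L, Vm N `|` Vm L = T, Vm N != T & Vm L != T].

Definition ztg_edge N L : bool :=
  `[< [/\ ztg_vertex N, ztg_vertex L, N != L & Vm N `|` Vm L = T] >].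

Lemma ztg_edge_vertices N L : ztg_edge N L -> ztg_vertex N /\ ztg_vertex L.
Proof. by move=> /asboolP[]. Qed.

Lemma ztg_edge_sym : symmetric ztg_edge.
Proof.
by move=> N L; apply/asboolP/asboolP => -[vN vL neq cov]; split;
  rewrite // 1?eq_sym 1?setUC.
Qed.

Lemma ztg_edge_irrefl : irreflexive ztg_edge.
Proof. by move=> N; apply/asboolP => -[_ _]; rewrite eqxx. Qed.

Definition zariski_topology_graph : sgraph (set M) :=
  SGraph ztg_edge_vertices ztg_edge_sym ztg_edge_irrefl.

End TopologyGraph.
End Modules.

(* Main.v *)
Require Import Defs.
From mathcomp Require Import all_boot all_order all_algebra.
From mathcomp Require Import boolp classical_sets constructive_ereal.

(* The ideal (Q : M) of a maximal submodule Q is prime, so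
   Vm (N `&` L) = Vm N `|` Vm L.  Hence, if A - N and B - L are edges and
   Vm A `|` Vm B is not T, the intersection of A and B is a vertex adjacent to
   both N and L.  Applied to a neighbour A of N and a neighbour B of L, this
   joins any two vertices by a path of length at most 3; applied to the ends of
   a path A - N - L - B of a cycle, it gives a triangle unless A and B are
   adjacent, which gives a 4-cycle. *)

Set Implicit Arguments.
Unset Strict Implicit.

Local Open Scope classical_set_scope.
Local Open Scope ring_scope.

Import Order.TTheory GRing.Theory Num.Theory.

Lemma enat_inf_le (A : set nat) (n : nat) : A n -> (enat_inf A <= n%:Z%:E)%E.
Proof.
move=> An; rewrite /enat_inf; case: pselect => [exA|nexA].
  by rewrite lee_fin lez_nat; case: ex_minnP => m _; apply; apply/asboolP.
by exfalso; apply: nexA; exists n; apply/asboolP.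
Qed.

(** [enat_sup] is an infimum of natural upper bounds, and [n] is one of them. *)
Lemma enat_sup_le (B : set (\bar int)) (n : nat) :
  (forall b, B b -> (b <= n%:Z%:E)%E) -> (enat_sup B <= n%:Z%:E)%E.
Proof. exact: enat_inf_le. Qed.

Section Submodules.
Variables (R : comNzRingType) (M : lmodType R).
Implicit Types N L Q : set M.

(** Passes from the boolean membership of [mem N] to the [Prop]-valued set [N]. *)
Lemma submoduleE N :
  submodule N <->
  N 0 /\ forall (a : R) (u v : M), N u -> N v -> N (a *: u + v).
Proof.
split=> [[N0 NZD]|[N0 NZD]]; split.
- exact: set_mem N0.
- by move=> a u v Nu Nv; apply/set_mem/NZD; apply/mem_set.
- exact: mem_set N0.
- by move=> a u v /set_mem Nu /set_mem Nv; apply/mem_set/NZD.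
Qed.

Lemma submoduleZ N (a : R) (u : M) : submodule N -> N u -> N (a *: u).
Proof. by move=> /submoduleE[N0 NZD] Nu; rewrite -[_ *: _]addr0; exact: NZD. Qed.

Lemma submoduleI N L : submodule N -> submodule L -> submodule (N `&` L).
Proof.
move=> /submoduleE[N0 NZD] /submoduleE[L0 LZD]; apply/submoduleE; split=> //.
by move=> a u v [Nu Lu] [Nv Lv]; split; [exact: NZD|exact: LZD].
Qed.

Lemma proper_submoduleI N L :
  proper_submodule N -> proper_submodule L -> proper_submodule (N `&` L).
Proof.
move=> [sN /eqP NT] [sL _]; split; first exact: submoduleI.
apply/eqP => NLT; apply: NT; apply/seteqP; split=> // x _.
by have [] : (N `&` L) x by rewrite NLT.
Qed.

(** Multiplication by [s] is linear because [R] is commutative. *)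
Lemma submodule_scale_preimage Q (s : R) :
  submodule Q -> submodule [set y | Q (s *: y)].
Proof.
move=> /submoduleE[Q0 QZD]; apply/submoduleE; split=> [|a u v Qu Qv] /=.
  by rewrite scaler0.
by rewrite scalerDr scalerA mulrC -scalerA; exact: QZD.
Qed.

(** The preimage of [Q] under multiplication by [s] is a submodule containing [Q]. By maximality it
    is all of [M], which puts [s] in [colon Q], or it is [Q], and then [s *: (r *: x)] in [Q] forces
    [r *: x] in [Q]. *)
Lemma colon_Max_prime Q (r s : R) :
  Max Q -> colon Q (r * s) -> colon Q r \/ colon Q s.
Proof.
move=> [[sQ _] maxQ] Qrs.
have [PT|/eqP PnT] := pselect ([set y | Q (s *: y)] = setT).
  by right=> x; have : [set y | Q (s *: y)] x by rewrite PT.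
left=> x; rewrite -(maxQ [set y | Q (s *: y)]).
- by rewrite /= scalerA mulrC; exact: Qrs.
- by split=> //; exact: submodule_scale_preimage.
- by move=> y /=; exact: submoduleZ.
Qed.

Lemma VmI N L : submodule N -> submodule L -> Vm (N `&` L) = Vm N `|` Vm L.
Proof.
move=> sN sL; apply/seteqP; split=> Q.
  (* If [Q] is in neither set, take [r] in [colon N] and [s] in [colon L], both outside [colon Q].
     Their product lies in the colon of the intersection, hence in [colon Q], against primality. *)
  move=> [maxQ sub]; apply: contrapT => /not_orP[].
  move=> /not_andP[//|/existsNP[r /not_implyP[Nr Qr]]].
  move=> /not_andP[//|/existsNP[s /not_implyP[Ls Qs]]].
  have /sub/(colon_Max_prime maxQ)[] // : colon (N `&` L) (r * s).
  move=> x; split; first by rewrite -scalerA; exact: Nr.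
  by rewrite mulrC -scalerA; exact: Ls.
by move=> -[] [maxQ sub]; split=> // r NLr; apply: sub => x; have [] := NLr x.
Qed.

End Submodules.

Section TopologyGraph.
Variables (R : comNzRingType) (M : lmodType R) (T : set (set M)).
Implicit Types A B N L : set M.
Notation G := (zariski_topology_graph T).

(** Each end witnesses that the other is a vertex, and equal ends would give [Vm N = T]. *)
Lemma ztg_edgeP N L :
  ztg_edge T N L <->
  [/\ proper_submodule N, proper_submodule L, Vm N != T, Vm L != T
     & Vm N `|` Vm L = T].
Proof.
split=> [/asboolP[[pN [? [_ _ NT _]]] [pL [? [_ _ LT _]]] _ cov]|] //.
move=> [pN pL NT LT cov]; apply/asboolP; split=> //.
- by split=> //; exists L.
- by split=> //; exists N; rewrite setUC.
- by apply: contra NT => /eqP NL; rewrite -cov -NL setUid.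
Qed.

Lemma ztg_vertex_edge N : ztg_vertex T N -> exists A, ztg_edge T N A.
Proof. by move=> [pN [L [pL cov NT LT]]]; exists L; apply/ztg_edgeP. Qed.

(** By [VmI] the intersection has [Vm] equal to the union, which differs from [T] by hypothesis.
    Being inside [T] and containing [Vm A] and [Vm B], it covers [T] together with [Vm N] as well as
    with [Vm L]. *)
Lemma ztg_edge_setI A B N L :
  ztg_edge T A N -> ztg_edge T B L -> Vm A `|` Vm B <> T ->
  ztg_edge T (A `&` B) N /\ ztg_edge T (A `&` B) L.
Proof.
move=> /ztg_edgeP[pA pN _ NT covN] /ztg_edgeP[pB pL _ LT covL] /eqP ABT.
have VAB : Vm (A `&` B) = Vm A `|` Vm B by apply: VmI; [case: pA|case: pB].
have pAB := proper_submoduleI pA pB.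
have subT : Vm A `|` Vm B `<=` T.
  by rewrite subUset; split; [rewrite -covN|rewrite -covL]; exact: subsetUl.
split; apply/ztg_edgeP; split; rewrite ?VAB //; apply/seteqP; split.
- by rewrite subUset; split=> //; rewrite -covN; exact: subsetUr.
- by rewrite -{1}covN; apply: setSU; exact: subsetUl.
- by rewrite subUset; split=> //; rewrite -covL; exact: subsetUr.
- by rewrite -{1}covL; apply: setSU; exact: subsetUr.
Qed.

(** Since [distance] is an infimum over walks, no distinctness of [N], [L] and the chosen neighbours
    has to be checked. *)
Lemma ztg_walk_le3 N L :
  ztg_vertex T N -> ztg_vertex T L -> exists2 n, (n <= 3)%N & walk G N L n.
Proof.
move=> vN vL.
have [A NA] := ztg_vertex_edge vN; have [B LB] := ztg_vertex_edge vL.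
have AN : ztg_edge T A N by rewrite ztg_edge_sym.
have BL : ztg_edge T B L by rewrite ztg_edge_sym.
have [AB|nAB] := pselect (Vm A `|` Vm B = T).
  exists 3 => //; exists [:: A; B; L]; split=> //=; rewrite NA BL /= andbT.
  have /ztg_edgeP[pA _ AT _ _] := AN; have /ztg_edgeP[pB _ BT _ _] := BL.
  by apply/ztg_edgeP; split.
have [KN KL] := ztg_edge_setI AN BL nAB.
exists 2 => //; exists [:: A `&` B; L]; split=> //=.
by rewrite ztg_edge_sym KN KL.
Qed.

Lemma ztg_short_cycle A N L B :
  uniq [:: A; N; L; B] -> path (ztg_edge T) A [:: N; L; B] ->
  exists2 c, is_graph_cycle G c & (size c <= 4)%N.
Proof.
move=> uc /= /and4P[AN NL LB _].
have BL : ztg_edge T B L by rewrite ztg_edge_sym.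
have [AB|nAB] := pselect (Vm A `|` Vm B = T).
  exists [:: A; N; L; B] => //; split=> //; rewrite /= AN NL LB /= andbT.
  rewrite ztg_edge_sym; apply/ztg_edgeP.
  by have /ztg_edgeP[] := AN; have /ztg_edgeP[] := BL; split.
have [KN KL] := ztg_edge_setI AN BL nAB.
(* The triangle's vertices are pairwise adjacent, hence distinct, even if the intersection is [A] or
   [B] itself. *)
have neq X Y : ztg_edge T X Y -> X != Y.
  by apply: contraTneq => ->; rewrite ztg_edge_irrefl.
exists [:: A `&` B; N; L] => //; split=> //=.
  by rewrite !inE negb_or !neq.
by rewrite KN NL ztg_edge_sym KL.
Qed.

End TopologyGraph.

Theorem theorem3p6 (R : comNzRingType) (M : lmodType R) (T : set (set M))
    (T_neq0 : T !=set0) (T_sub_Max : T `<=` @Max R M) :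
  connected_graph (zariski_topology_graph T) /\
  (diam (zariski_topology_graph T) <= (3%:Z)%:E)%E /\
  ((exists c : seq (set M), is_graph_cycle (zariski_topology_graph T) c) ->
   (gr (zariski_topology_graph T) <= (4%:Z)%:E)%E).
Proof.
split; [|split].
- by move=> N L vN vL; have [n _ w] := ztg_walk_le3 vN vL; exists n.
- apply: enat_sup_le => _ [N [L [vN vL ->]]].
  have [n n3 w] := ztg_walk_le3 vN vL.
  by apply: le_trans (enat_inf_le w) _; rewrite lee_fin lez_nat.
- move=> [c cycc].
  have [d cycd d4] : exists2 d, is_graph_cycle (zariski_topology_graph T) d
                               & (size d <= 4)%N.
    have [c4|] := leqP (size c) 4; first by exists c.
    (* The first four vertices of a longer cycle are distinct and form a path. *)
    case: c cycc => [|A [|N [|L [|B c]]]] // [_ uc /= /and4P[AN NL LB _]] _.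
    apply: (@ztg_short_cycle _ _ T A N L B); last by rewrite /= AN NL LB.
    exact: (subseq_uniq (prefix_subseq [:: A; N; L; B] c) uc).
  apply: (@le_trans _ _ (size d)%:Z%:E); last by rewrite lee_fin lez_nat.
  by apply: enat_inf_le; exists d.
Qed.
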